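(* Let $\nu$ and $\varphi_0$ be probability measures on $[0,1]$ such that $\nu^{[-1,1]}$ and $\varphi_0^{[-1,1]}$ do not have atoms at zero. Let $\xi_0$ have law $\varphi_0^{[-1,1]}$, let $\xi_1,\xi_2,\dots$ be i.i.d. with law $\nu^{[-1,1]}$, and let $T_\alpha$ have distribution $\mathbb P(T_\alpha=t)=(1-\alpha)\alpha^t$, $t=0,1,2,\dots$, with $\alpha\in(0,1)$, all independent. (Here $\frac12\big(1-\prod_{j=0}^{t}\xi_j\big)$ has as its law the de Finetti measure of $X_t$ in the random walk $X_{t+1}=X_t+Z_t\bmod2$ on $\{0,1\}^\infty$ with i.i.d. de Finetti increments of measure $\nu$ and initial de Finetti measure $\varphi_0$, and $T_\alpha$ is a stopping time of the walk.) Then, for $\theta\geq 0$, the Laplace transform of $-\log\prod_{j=0}^{T_\alpha}|\xi_j|$ jointly with the probability of a positive/negative sign of $\prod_{k=0}^{T_\alpha}\xi_k$, that is $\mathbb E\big[\mathbb I\{\pm\prod_{k=0}^{T_\alpha}\xi_k>0\}\,e^{-\theta(-\log\prod_{j=0}^{T_\alpha}|\xi_j|)}\big]$, is $$\frac12\Big(1+\frac{\alpha}{1-\alpha}\int_{[-1,1]}(1-|\xi|^\theta)\,\nu^{[-1,1]}(d\xi)\Big)^{-1}\Big(\int_{[-1,1]}|\xi|^\theta\varphi_0^{[-1,1]}(d\xi)\Big)$$ $$\pm\frac12(1-\alpha)\Big(1-\alpha\Big(-\int_{[-1,0]}|\xi|^\theta\nu^{[-1,1]}(d\xi)+\int_{(0,1]}|\xi|^\theta\nu^{[-1,1]}(d\xi)\Big)\Big)^{-1}\Big(-\int_{[-1,0]}|\xi|^\theta\varphi_0^{[-1,1]}(d\xi)+\int_{(0,1]}|\xi|^\theta\varphi_0^{[-1,1]}(d\xi)\Big).$$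 The marginal Laplace transform of $-\log\prod_{j=0}^{T_\alpha}|\xi_j|$ is $$\Big(1+\frac{\alpha}{1-\alpha}\int_{[-1,1]}\big(1-|\xi|^\theta\big)\nu^{[-1,1]}(d\xi)\Big)^{-1}\Big(\int_{[-1,1]}|\xi|^\theta\varphi_0^{[-1,1]}(d\xi)\Big),$$ and the marginal probability of a positive/negative sign of $\prod_{k=0}^{T_\alpha}\xi_k$ is $$\frac12\Big(1\pm\frac{1}{1+\frac{2\alpha}{1-\alpha}\nu\big([\frac12,1]\big)}\Big(1-2\varphi_0\big([\tfrac12,1]\big)\Big)\Big).$$
   Context: For a probability measure $\mu$ on $[0,1]$, $\mu^{[-1,1]}$ denotes the law of $1-2\omega$ when $\omega$ has law $\mu$. A de Finetti sequence with measure $\mu$ is an exchangeable $\{0,1\}$-valued sequence which, conditionally on $\omega$ with law $\mu$, is i.i.d. Bernoulli$(\omega)$. *)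

(* Defs.v *)
From HB Require Import structures.
From mathcomp Require Export all_boot all_order all_algebra perm finmap.
From mathcomp Require Export all_classical all_reals all_analysis.
From mathcomp Require Export measurable_realfun bernoulli_distribution.
Export Order.TTheory GRing.Theory Num.Theory.
Export numFieldNormedType.Exports.

Set Implicit Arguments.
Unset Strict Implicit.
Unset Printing Implicit Defensive.

Local Open Scope classical_set_scope.
Local Open Scope ring_scope.

Section Laws.
Context {R : realType}.

Definition on_unit_interval (mu : probability R R) : Prop :=
  mu `[0%R, 1%R]%classic = 1%E.

Definition affine_flip : R -> R :=
  fun w => 1 - 2 * w.

Lemma measurable_affine_flip : measurable_fun setT affine_flip.
Proof. by apply: measurable_funB => //; exact: measurable_funM. Qed.

HB.instance Definition _ :=
  isMeasurableFun.Build _ _ _ _ affine_flip measurable_affine_flip.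

(* The law of [1 - 2 w], which lives on [[-1, 1]]. *)
Definition sym_law (mu : probability R R) :
    probability R R :=
  distribution mu affine_flip.

Context {d : measure_display} {Omega : measurableType d}.
Variable P : probability Omega R.

Definition has_law (X : {RV P >-> R})
    (mu : probability R R) : Prop :=
  forall A : set R,
    measurable A -> distribution P X A = mu A.

Definition geometric_time (alpha : R) (T : {RV P >-> nat}) : Prop :=
  forall t : nat, P [set w | T w = t] = ((1 - alpha) * alpha ^+ t)%:E.

Definition product_parameter (xi : nat -> {RV P >-> R})
    (t : nat) : Omega -> R :=
  fun w => 2^-1 * (1 - \prod_(j < t.+1) xi j w).

Lemma measurable_product_parameter xi t :
  measurable_fun setT (product_parameter xi t).
Proof.
apply: measurable_funM => //; apply: measurable_funB => //.
by apply: measurable_prod => j _; exact: measurable_funPT.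
Qed.

HB.instance Definition _ xi t :=
  isMeasurableFun.Build _ _ _ _ (product_parameter xi t)
    (measurable_product_parameter xi t).

End Laws.

Arguments has_law {R d Omega} P X mu.
Arguments geometric_time {R d Omega} P alpha T.

Section Independence.
Context {R : realType} {d : measure_display} {Omega : measurableType d}.

(* A random sequence [X : nat -> {mfun Omega >-> bool}] generates the
   sigma-algebra generated by its coordinates, i.e. the preimage of the
   product sigma-algebra of [{0,1}^oo]. *)
Definition sigma_of_sequence (X : nat -> {mfun Omega >-> bool}) :
    set (set Omega) :=
  <<s \bigcup_i g_sigma_algebra_preimage (X i) >>.

Definition mutually_independent (P : probability Omega R) (I : choiceType)
    (G : I -> set (set Omega)) : Prop :=
  forall (J : {fset I}) (A : I -> set Omega),
    (forall j, j \in J -> G j (A j)) ->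
    P (\bigcap_(j in [set` J]) A j) = (\prod_(j <- J) P (A j))%E.

(* [G0] adjoined, at index [None], to the family [G]. *)
Definition adjoin (I : Type) (G0 : set (set Omega)) (G : I -> set (set Omega)) :
    option I -> set (set Omega) :=
  oapp G G0.

End Independence.

Section Walk.
Context {R : realType} {d : measure_display} {Omega : measurableType d}.
Variable P : probability Omega R.
Implicit Types (X : nat -> {mfun Omega >-> bool})
  (mu : probability R R).

Definition exchangeable X : Prop :=
  forall (n : nat) (s : {perm 'I_n}) (b : 'I_n -> bool),
    P [set w | forall i : 'I_n, X (s i) w = b i] =
    P [set w | forall i : 'I_n, X i w = b i].

(* "Conditionally on [p] with law [mu], i.i.d. Bernoulli([p])" is expressed by
   the finite-dimensional distributions, so that the mixing variable need not
   be carried by [Omega]. *)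
Definition de_finetti_sequence mu X : Prop :=
  [/\ on_unit_interval mu, exchangeable X &
    forall (n : nat) (b : 'I_n -> bool),
      P [set w | forall i : 'I_n, X i w = b i] =
      (\int[mu]_(p in `[0%R, 1%R])
         (\prod_(i < n) bernoulli_pmf (p : R) (b i))%:E)%E].

(* [X t] is the state at time [t], [X t i] its [i]-th coordinate;
   [(+)] is addition mod 2. *)
Definition de_finetti_walk nu phi0
    (X Z : nat -> nat -> {mfun Omega >-> bool}) : Prop :=
  [/\ de_finetti_sequence phi0 (X 0%N),
      (forall t, de_finetti_sequence nu (Z t)),
      mutually_independent P
        (adjoin (sigma_of_sequence (X 0%N)) (fun t => sigma_of_sequence (Z t))) &
      forall t i w, X t.+1 i w = X t i w (+) Z t i w].

(* Stopping time of the walk as a Markov chain, i.e. with respect to some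
   filtration to which the walk is adapted and whose past at each time is
   independent of the next increment; the natural filtration of the walk would
   be too small for a time that is independent of the walk. *)
Definition stopping_time_of_walk (X Z : nat -> nat -> {mfun Omega >-> bool})
    (T : {mfun Omega >-> nat}) : Prop :=
  exists F : nat -> set (set Omega),
    [/\ (forall t, sigma_algebra setT (F t) /\ F t `<=` measurable),
        (forall s t, (s <= t)%N -> F s `<=` F t),
        (forall t, sigma_of_sequence (X t) `<=` F t),
        (forall t, mutually_independent P
           (fun b : bool => if b then F t else sigma_of_sequence (Z t))) &
        forall t, F t [set w | (T w <= t)%N]].

End Walk.

(* Main.v *)
From HB Require Import structures.
Require Import Defs.
From mathcomp Require Import all_boot all_order all_algebra perm finmap.
From mathcomp Require Import all_classical all_reals all_analysis measurable_realfun bernoulli_distribution.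
From mathcomp Require Import ring lra.

(** Write M_t for the product of xi_0, ..., xi_t.  The transforms and the law of
    the walk are instances of one observation.  Let (F_c), c in a finite set, be
    nonnegative functions that multiply by a rule
      F_b (x * y) = sum over c of F_c x * F_(op b c) y   on [-1, 1].
    Since M_(t+1) = M_t * xi_(t+1) with independent factors, the expectations
    of the F_c (M_t) satisfy the same rule as a recursion in t
    ([partial_product_recursion]).

    For the transforms, c is a sign and F_c x is |x|^theta on the half-line of
    sign c ([signed_powerM]).  The sum and the difference of the two signed
    moments diagonalise the recursion, so both are geometric in t
    ([signed_power_partial_product]); summing them against the geometric law of
    the independent time T gives the stated closed form.  Keeping the two signs
    apart makes all integrands nonnegative, so that Tonelli and monotone
    convergence apply without any integrability discussion.  The marginal
    transform is the sum over the two signs, because the stopped product almost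
    surely does not vanish, and the marginal sign is the case theta = 0.

    For the walk, c is a word of n bits and F_c x is the probability that n
    independent Bernoulli variables of parameter (1 - x)/2 spell c.  For a
    single bit, P(1) = (1 - x)/2, and addition mod 2 of independent bits
    multiplies the numbers x; this is the rule with op the bitwise sum
    ([signed_likelihoodM]).  The cylinder probabilities of X_t obey the same
    recursion with the same initial values, hence X_t is the mixture with the
    law of (1 - M_t)/2 as mixing measure ([walk_de_finetti]).

    Independence is used for blocks of variables: the past of the walk and its
    next increment, the product M_t and the next factor or the time T.  All
    these cases follow from a single grouping lemma, proved by the uniqueness of
    measures on a pi-system ([independent_grouping]).  The same lemma shows that
    an independent time is a stopping time, with the filtration generated by
    that time together with the past of the walk
    ([stopping_time_of_independent]). *)

Set Implicit Arguments.
Unset Strict Implicit.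
Unset Printing Implicit Defensive.

Local Open Scope classical_set_scope.
Local Open Scope ring_scope.

(** * Independence *)

Section Independence.
Context {R : realType} {d : measure_display} {Omega : measurableType d}.
Variable P : probability Omega R.
Implicit Types (A B : set Omega).

Definition independent_classes (G H : set (set Omega)) : Prop :=
  forall A B, G A -> H B -> P (A `&` B) = (P A * P B)%E.

Lemma sigma_algebraT (G : set (set Omega)) : sigma_algebra setT G -> G setT.
Proof. by case=> G0 GC _; rewrite -(setD0 setT); exact: GC. Qed.

Lemma sigma_algebraI (G : set (set Omega)) :
  sigma_algebra setT G -> setI_closed G.
Proof.
case=> G0 GC GU A B GA GB; rewrite -(setCK (A `&` B)) setCI -bigcup2E -setTD.
by apply: (GC); apply: GU => -[|[|n]] //=; rewrite -setTD; exact: GC.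
Qed.

(** Intersections of finitely many events taken from different classes: the
    product rule of [mutually_independent] is about these events only, and they
    form a pi-system that generates the join of the classes. *)
Definition finite_meets (I : choiceType) (G : I -> set (set Omega))
    (S : set I) : set (set Omega) :=
  [set C | exists (J : {fset I}) (A : I -> set Omega),
    [/\ [set` J] `<=` S, forall j, G j (A j) & C = \bigcap_(j in [set` J]) A j]].

Lemma finite_meets_setI (I : choiceType) (G : I -> set (set Omega)) S :
  (forall i, sigma_algebra setT (G i)) -> setI_closed (finite_meets G S).
Proof.
move=> sG _ _ [J [A [JS GA ->]]] [J' [A' [JS' GA' ->]]].
(* padding by setT outside the index set puts both meets on the union J `|` J' *)
pose patch (K : {fset I}) (B : I -> set Omega) j := if j \in K then B j else setT.
have patchG (K : {fset I}) (B : I -> set Omega) (j : I) :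
    (forall j, G j (B j)) -> G j (patch K B j).
  by rewrite /patch; case: ifP => // _ _; exact: sigma_algebraT.
exists (J `|` J')%fset, (fun j => patch J A j `&` patch J' A' j); split.
- by move=> j /=; rewrite inE => /orP[/JS|/JS'].
- by move=> j; apply: (sigma_algebraI (sG j)); exact: patchG.
- apply/seteqP; split=> w.
    by move=> [AJ AJ'] j _; split; rewrite /patch; case: ifP => // jJ;
      [exact: AJ|exact: AJ'].
  move=> h; split=> j /= jJ; have /h[] : j \in (J `|` J')%fset by rewrite inE jJ ?orbT.
    by rewrite /patch jJ.
  by rewrite /patch jJ.
Qed.

(** Independence extends from a pi-system to the sigma-algebra it generates:
    [A |-> P (A `&` B)] and [A |-> P A * P B] are finite measures that agree on
    the pi-system. *)
Lemma independent_generated (G : set (set Omega)) (B : set Omega) :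
  setI_closed G -> G setT -> G `<=` measurable -> measurable B ->
  (forall A, G A -> P (A `&` B) = (P A * P B)%E) ->
  forall A, <<s G >> A -> P (A `&` B) = (P A * P B)%E.
Proof.
move=> GI GT Gm mB GB A GA.
have PB0 : 0 <= fine (P B) by exact: fine_ge0.
rewrite muleC -(fineK (fin_num_measure P B mB)).
apply: (g_sigma_algebra_measure_unique G Gm (fun _ => setT) _ _
  (mrestr P mB) (mscale (NngNum PB0) P)) => //=.
- by rewrite bigcup_const.
- move=> C GC; rewrite /mrestr /mscale /= fineK ?fin_num_measure// muleC.
  exact: GB.
- by move=> _; rewrite /mrestr; rewrite ltey_eq fin_num_measure// setTI.
Qed.

(** The join of the classes indexed by S is independent of any class outside S;
    by [independent_generated] it is enough to adjoin B, at the fresh index k,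
    to a finite meet over S. *)
Lemma independent_grouping (I : choiceType) (G : I -> set (set Omega))
    (S : set I) (k : I) :
  mutually_independent P G -> (forall i, sigma_algebra setT (G i)) ->
  (forall i, G i `<=` measurable) -> ~ S k ->
  independent_classes <<s \bigcup_(i in S) G i >> (G k).
Proof.
move=> indG sG mG Sk A B GA GB.
apply: (@independent_generated (finite_meets G S)).
- exact: finite_meets_setI.
- exists fset0, (fun=> setT); split=> //; first by move=> j; exact: sigma_algebraT.
  by apply/seteqP; split.
- move=> _ [J [C [_ GC ->]]]; apply: fin_bigcap_measurable => // j _.
  exact: mG (GC j).
- exact: mG GB.
- move=> _ [J [C [JS GC ->]]].
  have kJ : k \notin J by apply/negP => /JS.
  pose C' j := if j == k then B else C j.
  have eqC j : j \in J -> C' j = C j.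
    by move=> jJ; rewrite /C'; case: eqP jJ kJ => // -> ->.
  have GC' j : G j (C' j) by rewrite /C'; case: eqP => [->|].
  have -> : \bigcap_(j in [set` J]) C j `&` B =
      \bigcap_(j in [set` (k |` J)%fset]) C' j.
    apply/seteqP; split=> w.
      move=> [h wB] j /=; rewrite !inE /C'; case: eqP => [//|_ /= jJ].
      exact: h.
    move=> h; split; last first.
      by have /= := h k; rewrite /C' eqxx; apply; rewrite !inE eqxx.
    by move=> j /= jJ; rewrite -eqC//; apply: h; rewrite /= !inE jJ orbT.
  have C'k : C' k = B by rewrite /C' eqxx.
  rewrite indG// big_fsetU1//= C'k muleC indG//; congr (_ * _)%E.
  by rewrite !big_seq; apply: eq_bigr => j jJ; rewrite eqC.
- move: GA; apply: smallest_sub; first exact: smallest_sigma_algebra.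
  move=> C [i Si GC]; apply: sub_sigma_algebra.
  exists [fset i]%fset, (fun j => if j == i then C else setT); split.
  + by move=> j /=; rewrite inE => /eqP ->.
  + by move=> j; case: eqP => [->//|_]; exact: sigma_algebraT.
  + apply/seteqP; split=> w.
      by move=> wC j /=; rewrite inE => ->.
    by move=> /(_ i); rewrite /= eqxx; apply; rewrite inE.
Qed.

Lemma mutually_independent2 (G H : set (set Omega)) :
  sigma_algebra setT G -> sigma_algebra setT H -> independent_classes G H ->
  mutually_independent P (fun b : bool => if b then G else H).
Proof.
move=> sG sH GH J A GA.
have {}GA j : j \in J -> (if j then G else H) (A j) by move=> jJ; exact: GA.
pose A' j := if j \in J then A j else setT.
have GA' b : (if b then G else H) (A' b).
  by rewrite /A'; case: (boolP (b \in J)) => [/GA//|_]; case: b; exact: sigma_algebraT.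
have -> : \bigcap_(j in [set` J]) A j = A' true `&` A' false.
  apply/seteqP; split=> w; rewrite /A'.
    by move=> h; split; case: ifPn => // jJ; exact: h.
  move=> [h1 h2] [] /= jJ; first by rewrite jJ in h1.
  by rewrite jJ in h2.
rewrite GH; [|exact: (GA' true)|exact: (GA' false)].
rewrite big_uniq ?fset_uniq// big_mkcond big_bool /A'.
by do 2![case: ifPn => // _]; rewrite probability_setT.
Qed.

(** Independence says that the joint law of X and Y is the product of their
    laws, and Tonelli factorises the integral against a product measure. *)
Lemma independent_integralM (d1 d2 : measure_display)
    (T1 : measurableType d1) (T2 : measurableType d2)
    (X : {RV P >-> T1}) (Y : {RV P >-> T2})
    (f : T1 -> \bar R) (g : T2 -> \bar R) :
  independent_classes (g_sigma_algebra_preimage X)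
    (g_sigma_algebra_preimage Y) ->
  measurable_fun setT f -> measurable_fun setT g ->
  (forall x, 0 <= f x)%E -> (forall y, 0 <= g y)%E ->
  (\int[P]_w (f (X w) * g (Y w)) =
   \int[P]_w f (X w) * \int[P]_w g (Y w))%E.
Proof.
move=> XY mf mg f0 g0.
have mZ : measurable_fun setT (fun w => (X w, Y w)).
  by apply: measurable_fun_pair; exact: measurable_funPT.
pose Z : {RV P >-> (T1 * T2)%type} := mfun_Sub (mem_set mZ).
pose h (z : T1 * T2) := (f z.1 * g z.2)%E.
have mh : measurable_fun setT h.
  apply: emeasurable_funM.
    exact: (measurableT_comp mf measurable_fst).
  exact: (measurableT_comp mg measurable_snd).
have h0 z : (0 <= h z)%E by apply: mule_ge0.
transitivity (\int[distribution P Z]_z h z)%E.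
  by rewrite ge0_integral_distribution.
transitivity (\int[(distribution P X \x distribution P Y)]_z h z)%E.
  apply: eq_measure_integral => A mA _; apply/esym.
  apply: product_measure_unique => // B C mB mC.
  rewrite /= /distribution /pushforward -XY; last 2 first.
  - by exists B => //; rewrite setTI.
  - by exists C => //; rewrite setTI.
  by [].
rewrite fubini_tonelli1// /fubini_F /h/=.
under eq_integral.
  move=> x _; rewrite ge0_integralZl//; over.
rewrite -(ge0_integral_distribution X)// -(ge0_integral_distribution Y)//.
rewrite ge0_integralZr//.
by apply: integral_ge0.
Qed.

Lemma sigma_algebra_g_preimage d' (T' : measurableType d') (X : Omega -> T') :
  sigma_algebra setT (g_sigma_algebra_preimage X).
Proof. exact/sigma_algebra_preimage/sigma_algebra_measurable. Qed.

Lemma g_preimage_measurable d' (T' : measurableType d') (X : {mfun Omega >-> T'}) :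
  g_sigma_algebra_preimage X `<=` measurable.
Proof. by move=> _ [B mB <-]; exact: measurable_funPT. Qed.

End Independence.

(** * Partial products of independent factors *)

Section SignedLaw.
Context {R : realType}.
Implicit Types mu : probability R R.

Lemma affine_flip_itvcc (p : R) :
  (affine_flip p \in `[-1, 1]) = (p \in `[0, 1]).
Proof. by rewrite !in_itv /affine_flip /=; apply/andP/andP => -[? ?]; split; lra. Qed.

Lemma sym_law_unit_ball mu : on_unit_interval mu ->
  sym_law mu `[-1, 1]%classic = 1%E.
Proof.
move=> <-; rewrite /sym_law /= /distribution /pushforward; congr (mu _).
by apply/seteqP; split => p /=; rewrite affine_flip_itvcc.
Qed.

Lemma integral_sym_law mu (f : R -> \bar R) : measurable_fun setT f ->
  (forall x, 0 <= f x)%E ->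
  (\int[sym_law mu]_x f x = \int[mu]_p f (affine_flip p))%E.
Proof. by move=> mf f0; rewrite ge0_integral_distribution. Qed.

End SignedLaw.

Section AlmostSure.
Context {R : realType} {d : measure_display} {Omega : measurableType d}.
Variable P : probability Omega R.

Lemma probability1_ae (A : set Omega) : measurable A -> P A = 1%E ->
  {ae P, forall w, A w}.
Proof.
move=> mA PA; exists (~` A); split => //; first exact: measurableC.
by rewrite probability_setC// PA subee.
Qed.

Lemma has_law_integral (X : {RV P >-> R}) (mu : probability R R)
    (f : R -> \bar R) : has_law P X mu -> measurable_fun setT f ->
  (forall x, 0 <= f x)%E -> (\int[P]_w f (X w) = \int[mu]_x f x)%E.
Proof.
move=> XP mf f0; rewrite -(ge0_integral_distribution X)//.
by apply: eq_measure_integral => A mA _; exact: XP.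
Qed.

Lemma has_law_unit_ball (X : {RV P >-> R}) (mu : probability R R) :
  on_unit_interval mu -> has_law P X (sym_law mu) ->
  {ae P, forall w, -1 <= X w <= 1}.
Proof.
move=> mu01 XP.
have : P (X @^-1` `[-1, 1]) = 1%E.
  by rewrite -(sym_law_unit_ball mu01) -XP.
move/probability1_ae => /(_ (measurable_funPTI X _)).
move=> h; apply: filterS (h _) => // w /=; by rewrite in_itv.
Qed.

End AlmostSure.

Section PartialProduct.
Context {R : realType} {d : measure_display} {Omega : measurableType d}.
Variables (P : probability Omega R) (xi : nat -> {RV P >-> R}).

Definition partial_product (t : nat) (w : Omega) : R :=
  \prod_(j < t.+1) xi j w.

Lemma measurable_partial_product t : measurable_fun setT (partial_product t).
Proof. by apply: measurable_prod => j _; exact: measurable_funPT. Qed.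

HB.instance Definition _ t :=
  isMeasurableFun.Build _ _ _ _ (partial_product t)
    (measurable_partial_product t).

Lemma partial_product0 w : partial_product 0 w = xi 0 w.
Proof. by rewrite /partial_product big_ord_recl big_ord0 mulr1. Qed.

Lemma partial_productS t w :
  partial_product t.+1 w = partial_product t w * xi t.+1 w.
Proof. by rewrite /partial_product big_ord_recr. Qed.

(** Regarding the generated sigma-algebra as the measurable structure of the
    source makes the closure properties of measurable functions available for
    sub-sigma-algebras. *)
Lemma sub_sigma_algebra_preimage (G : set (set Omega)) (X : Omega -> R) :
  measurable_fun setT (X : g_sigma_algebraType G -> R) ->
  g_sigma_algebra_preimage X `<=` <<s G>>.
Proof. by move=> mX _ [B mB <-]; exact: mX. Qed.

Lemma partial_product_sigma (J : Type) (G : J -> set (set Omega)) (S : set J)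
    (t : nat) :
  (forall j, (j <= t)%N ->
     exists2 i, S i & g_sigma_algebra_preimage (xi j) `<=` G i) ->
  g_sigma_algebra_preimage (partial_product t) `<=` <<s \bigcup_(i in S) G i>>.
Proof.
move=> SG; apply: sub_sigma_algebra_preimage; apply: measurable_prod => j _.
move=> _ B mB; have [i Si xG] := SG j (ltn_ord j).
by apply: sub_sigma_algebra; exists i => //; apply: xG; exists B.
Qed.

End PartialProduct.

Section Product.
Context {R : realType} {d : measure_display} {Omega : measurableType d}.
Variables (P : probability Omega R) (nu phi0 : probability R R).
Variables (xi : nat -> {RV P >-> R}) (T : {RV P >-> nat}).
Hypotheses (nu01 : on_unit_interval nu) (phi001 : on_unit_interval phi0).
Hypothesis xi0_law : has_law P (xi 0%N) (sym_law phi0).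
Hypothesis xi_law : forall j : nat, has_law P (xi j.+1) (sym_law nu).
Hypothesis indep : mutually_independent P
     (adjoin (g_sigma_algebra_preimage T)
             (fun j : nat => g_sigma_algebra_preimage (xi j))).

Lemma partial_product_independent t (k : option nat) :
  (if k is Some j then (t < j)%N else true) ->
  independent_classes P (g_sigma_algebra_preimage (partial_product xi t))
    (adjoin (g_sigma_algebra_preimage T)
             (fun j : nat => g_sigma_algebra_preimage (xi j)) k).
Proof.
move=> kt A B MA.
apply: (independent_grouping
  (S := [set i | exists2 j, i = Some j & (j <= t)%N]) indep).
- by case=> [j|]; exact: sigma_algebra_g_preimage.
- by case=> [j|]; exact: g_preimage_measurable.
- by move=> [j kE jt]; move: kt; rewrite kE ltnNge jt.
- apply: (@partial_product_sigma _ _ _ _ xi) MA => j jt.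
  by exists (Some j) => //; exists j.
Qed.

Lemma partial_product_unit_ball t :
  {ae P, forall w, -1 <= partial_product xi t w <= 1}.
Proof.
have ball j : {ae P, forall w, -1 <= xi j w <= 1}.
  by case: j => [|j]; [exact: has_law_unit_ball xi0_law|
    exact: has_law_unit_ball (xi_law j)].
elim: t => [|t].
  by apply: filterS (ball 0%N) => w; rewrite partial_product0.
apply: filterS2 (ball t.+1) => w; rewrite -!ler_norml partial_productS normrM.
by move=> ? ?; rewrite mulr_ile1.
Qed.

(** The common engine of the transforms and of the walk.  The multiplication
    rule is only required on [-1, 1], where the factors live almost surely:
    Bernoulli likelihoods satisfy it only there. *)
Lemma partial_product_recursion (C : finType) (op : C -> C -> C)
    (F : C -> R -> R) :
  (forall c, measurable_fun setT (F c)) -> (forall c x, 0 <= F c x) ->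
  (forall b x y, -1 <= x <= 1 -> -1 <= y <= 1 ->
     F b (x * y) = \sum_c F c x * F (op b c) y) ->
  forall t b, (\int[P]_w (F b (partial_product xi t.+1 w))%:E =
    \sum_c (\int[P]_w (F c (partial_product xi t w))%:E *
            \int[sym_law nu]_x (F (op b c) x)%:E))%E.
Proof.
move=> mF F0 FM t b.
have mFE c : measurable_fun setT (fun x => (F c x)%:E) by exact/measurable_EFinP.
have F0E c x : (0 <= (F c x)%:E)%E by rewrite lee_fin.
have mFM c : measurable_fun setT (fun w => (F c (partial_product xi t w))%:E).
  exact: measurableT_comp (mFE c) _.
have mFxi c : measurable_fun setT (fun w => (F c (xi t.+1 w))%:E).
  exact: measurableT_comp (mFE c) _.
transitivity (\int[P]_w (\sum_c ((F c (partial_product xi t w))%:E *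
    (F (op b c) (xi t.+1 w))%:E)))%E.
  apply: ge0_ae_eq_integral => //.
  - exact: measurableT_comp (mFE b) _.
  - by apply: emeasurable_sum => c _; exact: emeasurable_funM.
  - by move=> w _; apply: sume_ge0 => c _; apply: mule_ge0.
  apply: filterS2 (partial_product_unit_ball t)
    (has_law_unit_ball nu01 (xi_law t)) => w Mw xw _.
  rewrite partial_productS FM//.
  by rewrite -sumEFin; apply: eq_bigr => c _; rewrite EFinM.
rewrite ge0_integral_sum//; last 2 first.
- by move=> c; exact: emeasurable_funM.
- by move=> c w _; apply: mule_ge0.
apply: eq_bigr => c _.
rewrite (independent_integralM (X := partial_product xi t) (Y := xi t.+1)
  (f := fun x => (F c x)%:E) (g := fun x => (F (op b c) x)%:E))//.
  by rewrite (has_law_integral (f := fun x => (F (op b c) x)%:E) (xi_law t)).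
exact: (@partial_product_independent t (Some t.+1)).
Qed.

Lemma partial_product_initial (f : R -> R) :
  measurable_fun setT f -> (forall x, 0 <= f x) ->
  (\int[P]_w (f (partial_product xi 0 w))%:E = \int[sym_law phi0]_x (f x)%:E)%E.
Proof.
move=> mf f0; under eq_integral do rewrite partial_product0.
by apply: (has_law_integral (f := EFin \o f) xi0_law) => //; exact/measurable_EFinP.
Qed.

Lemma bigcup_time : \bigcup_t [set w | T w = t] = [set: Omega].
Proof. by apply/seteqP; split=> // w _; exists (T w). Qed.

Lemma measurable_time t : measurable [set w | T w = t].
Proof. exact: (measurable_funPTI T (Y := [set t])). Qed.

Definition stopped_product (w : Omega) : R := partial_product xi (T w) w.

Lemma measurable_stopped_product : measurable_fun setT stopped_product.
Proof.
rewrite -bigcup_time.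
apply/measurable_fun_bigcup => [t|t]; first exact: measurable_time.
apply: (@eq_measurable_fun _ _ _ _ _ (partial_product xi t)).
  by move=> w; rewrite inE /stopped_product /= => ->.
exact: measurable_funTS.
Qed.

Lemma integral_stopped_product (f : R -> R) :
  measurable_fun setT f -> (forall x, 0 <= f x) ->
  (\int[P]_w (f (stopped_product w))%:E =
   \sum_(0 <= t <oo) (P [set w | T w = t] *
     \int[P]_w (f (partial_product xi t w))%:E))%E.
Proof.
move=> mf f0.
have mfE : measurable_fun setT (EFin \o f) by exact/measurable_EFinP.
have mS : measurable_fun (\bigcup_t [set w | T w = t])
    (fun w => (f (stopped_product w))%:E).
  rewrite bigcup_time.
  exact/measurable_EFinP/(measurableT_comp mf)/measurable_stopped_product.
have := ge0_integral_bigcup P measurable_time mS.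
rewrite bigcup_time => ->//; last 2 first.
- by move=> w _; rewrite lee_fin.
- by move=> i j _ _ [w [/= <- <-]].
apply: eq_eseriesr => t _.
transitivity
  (\int[P]_w ((f (partial_product xi t w))%:E * (\1_[set t] (T w))%:E))%E.
  rewrite integral_mkcond; apply: eq_integral => w _.
  rewrite patchE /stopped_product indicE; have [Tw|/eqP Tt] := eqVneq (T w) t.
    by rewrite !mem_set//= Tw mule1.
  by rewrite !memNset// mule0.
rewrite (independent_integralM (X := partial_product xi t) (Y := T)
  (f := EFin \o f) (g := fun n => (\1_[set t] n)%:E))//.
- rewrite muleC; congr (_ * _)%E.
  rewrite (_ : (fun w => _) = (fun w => (\1_[set w | T w = t] w)%:E))//.
  by rewrite integral_indic ?setIT//; exact: measurable_time.
- exact: (@partial_product_independent t None).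
Qed.

End Product.

(** * The moments carrying sign and modulus *)

Section SignedPower.
Context {R : realType}.
Implicit Types (theta : R) (s : bool).

Definition signed_power theta s (x : R) : R :=
  \1_[set y | 0 < (-1) ^+ s * y] x * `|x| `^ theta.

Lemma signed_powerE theta s x : signed_power theta s x =
  if 0 < (-1) ^+ s * x then `|x| `^ theta else 0.
Proof.
rewrite /signed_power indicE; case: ifPn => [h|/negP h].
  by rewrite mem_set// mul1r.
by rewrite memNset// mul0r.
Qed.

Lemma measurable_abs_powR theta : measurable_fun [set: R] (fun x => `|x| `^ theta).
Proof. exact: (measurableT_comp (measurable_powR theta) (@normr_measurable R setT)). Qed.

Lemma measurable_signed_power theta s : measurable_fun [set: R] (signed_power theta s).
Proof.
apply: measurable_funM (measurable_abs_powR _); apply: measurable_indic.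
have mg : measurable_fun setT (fun y : R => (-1) ^+ s * y) by exact: measurable_funM.
have := mg measurableT _ (measurable_itv `]0, +oo[); rewrite setTI.
by congr measurable; apply/seteqP; split => y /=; rewrite in_itv /= andbT.
Qed.

Lemma signed_power_ge0 theta s x : 0 <= signed_power theta s x.
Proof. by rewrite signed_powerE; case: ifP => // _; exact: powR_ge0. Qed.

(** The sign of a product is the sum mod 2 of the signs; at zero all terms
    vanish, so that no exception is needed. *)
Lemma signed_powerM theta s x y : signed_power theta s (x * y) =
  \sum_c signed_power theta c x * signed_power theta (s (+) c) y.
Proof.
rewrite big_bool !signed_powerE normrM powRM//.
have zero (c : bool) : (0 < (-1) ^+ c * (0 : R)) = false by rewrite mulr0 ltxx.
have pos (c : bool) (z : R) : 0 < z -> (0 < (-1) ^+ c * z) = ~~ c.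
  by case: c => z0; rewrite ?(expr1, expr0, mul1r, mulN1r, oppr_gt0, z0, lt_gtF z0).
have neg (c : bool) (z : R) : z < 0 -> (0 < (-1) ^+ c * z) = c.
  by case: c => z0; rewrite ?(expr1, expr0, mul1r, mulN1r, oppr_gt0, z0, lt_gtF z0).
case: (ltgtP x 0) => [x0|x0|->]; last by rewrite mul0r !zero /= !mul0r addr0.
  case: (ltgtP y 0) => [y0|y0|->]; last by rewrite mulr0 !zero /= !mulr0 addr0.
    have xy : 0 < x * y by rewrite nmulr_rgt0.
    by rewrite pos// !(neg _ x)// !(neg _ y)//; case: s; rewrite /=; ring.
  have xy : x * y < 0 by rewrite nmulr_rlt0.
  by rewrite neg// !(neg _ x)// !(pos _ y)//; case: s => /=; ring.
case: (ltgtP y 0) => [y0|y0|->]; last by rewrite mulr0 !zero /= !mulr0 addr0.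
  have xy : x * y < 0 by rewrite pmulr_rlt0.
  by rewrite neg// !(pos _ x)// !(neg _ y)//; case: s => /=; ring.
have xy : 0 < x * y by rewrite pmulr_rgt0.
by rewrite pos// !(pos _ x)// !(pos _ y)//; case: s => /=; ring.
Qed.

Lemma abs_powR_le1 theta x : 0 <= theta -> -1 <= x <= 1 -> `|x| `^ theta <= 1.
Proof.
move=> theta0; rewrite -ler_norml => x1.
apply: (@le_trans _ _ (1 `^ theta)); last by rewrite powR1.
by apply: ge0_ler_powR; rewrite ?nnegrE.
Qed.

End SignedPower.

Section SignedMoments.
Context {R : realType}.
Variable Q : probability R R.
Hypotheses (Q1 : Q `[-1, 1]%classic = 1%E) (Q0 : Q [set 0] = 0%E).
Variables (theta : R).
Hypothesis theta0 : 0 <= theta.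

Definition signed_moment (s : bool) : R := \int[Q]_x signed_power theta s x.

(** Integrands and domains that differ only off [-1, 1] or at 0 are
    interchangeable for Q.  This identifies integrals over half-open and closed
    half-intervals with the signed moments. *)
Lemma integral_unit_ball (D : set R) (f g : R -> R) :
  measurable D -> measurable_fun setT f -> measurable_fun setT g ->
  (forall x, D x -> 0 <= f x) -> (forall x, 0 <= g x) ->
  (forall x, -1 <= x <= 1 -> x != 0 -> g x = if x \in D then f x else 0) ->
  (\int[Q]_(x in D) (f x)%:E = \int[Q]_x (g x)%:E)%E.
Proof.
move=> mD mf mg f0 g0 fg; rewrite integral_mkcond.
apply: ge0_ae_eq_integral => //.
- by apply/(measurable_restrictT _ mD)/measurable_EFinP; exact: measurable_funTS.
- exact/measurable_EFinP.
- by move=> x _; rewrite patchE; case: ifPn => // /set_mem Dx; rewrite lee_fin f0.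
- by move=> x _; rewrite lee_fin.
have nz : {ae Q, forall x, x != 0}.
  by exists [set 0]; split => // x /= /negP; rewrite negbK => /eqP.
have ball : {ae Q, forall x, -1 <= x <= 1}.
  by apply: filterS (probability1_ae _ Q1) => // x; rewrite /= in_itv.
apply: filterS2 nz ball => x xn0 x1 _.
by rewrite patchE fg//; case: ifP.
Qed.

Let mf : measurable_fun setT (fun x : R => `|x| `^ theta).
Proof. exact: measurable_abs_powR. Qed.

(** An identity between nonnegative extended reals with sum 1: the finiteness
    of all the moments is read off from it. *)
Lemma integral_abs_powR_complement :
  (\int[Q]_(x in `[(-1)%R, 1%R]) (1 - `|x| `^ theta)%:E +
   \int[Q]_(x in `[(-1)%R, 1%R]) (`|x| `^ theta)%:E = 1)%E.
Proof.
rewrite -ge0_integralD//; first last.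
- exact/measurable_EFinP/measurable_funTS.
- by apply/measurable_EFinP; apply: measurable_funTS; exact: measurable_funB.
- by move=> x /=; rewrite in_itv/= => x1; rewrite lee_fin subr_ge0 abs_powR_le1.
under eq_integral do rewrite -EFinD subrK.
by rewrite integral_cst//= mul1e.
Qed.

Lemma integral_signed_power_add :
  (\int[Q]_(x in `[(-1)%R, 1%R]) (`|x| `^ theta)%:E =
   \int[Q]_x (signed_power theta false x)%:E +
   \int[Q]_x (signed_power theta true x)%:E)%E.
Proof.
have ge0 s (x : R) : (0 <= (signed_power theta s x)%:E)%E.
  by rewrite lee_fin signed_power_ge0.
have ms s : measurable_fun [set: R] (fun x => (signed_power theta s x)%:E).
  by apply/measurable_EFinP; exact: measurable_signed_power.
rewrite -ge0_integralD//.
under [RHS]eq_integral do rewrite -EFinD.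
apply: integral_unit_ball => //.
- by apply: measurable_funD; exact: measurable_signed_power.
- by move=> x; rewrite addr_ge0 ?signed_power_ge0.
move=> x x1 xn0; rewrite mem_set; last by rewrite /= in_itv.
rewrite !signed_powerE expr0 expr1 mul1r mulN1r oppr_gt0.
by case: (ltgtP x 0) xn0 => // x0 _; rewrite ?addr0 ?add0r.
Qed.

Lemma signed_moment_EFin s :
  (\int[Q]_x (signed_power theta s x)%:E = (signed_moment s)%:E)%E.
Proof.
rewrite /signed_moment /Rintegral fineK//.
have := integral_abs_powR_complement; rewrite integral_signed_power_add.
have h b : (0 <= \int[Q]_x (signed_power theta b x)%:E)%E.
  by apply: integral_ge0 => x _; rewrite lee_fin signed_power_ge0.
have k : (0 <= \int[Q]_(x in `[(-1)%R, 1%R]) (1 - `|x| `^ theta)%:E)%E.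
  apply: integral_ge0 => x /=; rewrite in_itv => x1.
  by rewrite lee_fin subr_ge0 abs_powR_le1.
move=> E; rewrite ge0_fin_numE//; apply: (@le_lt_trans _ _ 1%E); last exact: ltry.
rewrite -E; case: s; first by rewrite addeA leeDr// adde_ge0.
by rewrite addeCA leeDl// adde_ge0.
Qed.

Lemma signed_moment_ge0 s : 0 <= signed_moment s.
Proof. by apply: Rintegral_ge0 => x _; exact: signed_power_ge0. Qed.

Lemma Rintegral_abs_powR :
  \int[Q]_(x in `[-1, 1]) (`|x| `^ theta) = signed_moment false + signed_moment true.
Proof. by rewrite /Rintegral integral_signed_power_add !signed_moment_EFin. Qed.

Lemma Rintegral_abs_powR_complement :
  \int[Q]_(x in `[-1, 1]) (1 - `|x| `^ theta) =
  1 - (signed_moment false + signed_moment true).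
Proof.
have := integral_abs_powR_complement.
rewrite integral_signed_power_add !signed_moment_EFin -EFinD /Rintegral.
by case: integral => //= r [<-]; rewrite addrK.
Qed.

Lemma Rintegral_abs_powR_neg :
  \int[Q]_(x in `[-1, 0]) (`|x| `^ theta) = signed_moment true.
Proof.
rewrite /Rintegral; congr fine; apply: integral_unit_ball => //.
- exact: measurable_signed_power.
- exact: signed_power_ge0.
move=> x /andP[x1 _] xn0; rewrite signed_powerE expr1 mulN1r oppr_gt0.
by rewrite lt_neqAle xn0 /= mem_setE in_itv /= x1.
Qed.

Lemma Rintegral_abs_powR_pos :
  \int[Q]_(x in `]0, 1]) (`|x| `^ theta) = signed_moment false.
Proof.
rewrite /Rintegral; congr fine; apply: integral_unit_ball => //.
- exact: measurable_signed_power.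
- exact: signed_power_ge0.
move=> x /andP[_ x1] xn0; rewrite signed_powerE expr0 mul1r.
by rewrite mem_setE in_itv /= x1 andbT.
Qed.

Lemma signed_moment_sum_le1 : signed_moment false + signed_moment true <= 1.
Proof.
rewrite -subr_ge0 -Rintegral_abs_powR_complement; apply: Rintegral_ge0 => x /=.
by rewrite in_itv => x1; rewrite subr_ge0 abs_powR_le1.
Qed.

End SignedMoments.

(** * Transforms of the stopped product *)

Lemma nneseries_geometric2 (R : realType) (a1 z1 a2 z2 : R) :
  `|z1| < 1 -> `|z2| < 1 ->
  (\sum_(0 <= t <oo) (a1 * z1 ^+ t + a2 * z2 ^+ t)%:E =
   (a1 / (1 - z1) + a2 / (1 - z2))%:E)%E.
Proof.
move=> z1_1 z2_1; apply: cvg_lim => //.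
rewrite (_ : (fun n => _) = EFin \o series (geometric a1 z1 + geometric a2 z2)).
  apply: cvg_EFin; first by near=> n.
  rewrite seriesD; apply: cvgD; exact: cvg_geometric_series.
by apply/funext => n /=; rewrite sumEFin.
Unshelve. all: by end_near.
Qed.

Section Transform.
Context {R : realType} {d : measure_display} {Omega : measurableType d}.
Variables (P : probability Omega R) (nu phi0 : probability R R).
Variables (xi : nat -> {RV P >-> R}) (T : {RV P >-> nat}) (alpha : R).
Hypotheses (nu01 : on_unit_interval nu) (phi001 : on_unit_interval phi0).
Hypotheses (nu_noatom : sym_law nu [set 0] = 0%E)
  (phi0_noatom : sym_law phi0 [set 0] = 0%E).
Hypothesis alpha01 : 0 < alpha < 1.
Hypothesis xi0_law : has_law P (xi 0%N) (sym_law phi0).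
Hypothesis xi_law : forall j : nat, has_law P (xi j.+1) (sym_law nu).
Hypothesis T_law : geometric_time P alpha T.
Hypothesis indep : mutually_independent P
     (adjoin (g_sigma_algebra_preimage T)
             (fun j : nat => g_sigma_algebra_preimage (xi j))).

Lemma stopped_product_neq0 : {ae P, forall w, stopped_product xi T w != 0}.
Proof.
have xi_neq0 j : {ae P, forall w, xi j w != 0}.
  exists (xi j @^-1` [set 0]); split.
  - exact: (measurable_funPTI (xi j)).
  - by case: j => [|j]; [rewrite -phi0_noatom -xi0_law|
      rewrite -nu_noatom -(xi_law j)].
  - by move=> w /= /negP; rewrite negbK => /eqP.
have := ae_foralln xi_neq0.
apply: filterS => w h; rewrite /stopped_product /partial_product.
by apply/prodf_neq0 => j _; exact: h.
Qed.

Section FixedExponent.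
Variable theta : R.
Hypothesis theta0 : 0 <= theta.
Let m := signed_moment (sym_law nu) theta.
Let m0 := signed_moment (sym_law phi0) theta.
Let nuE := signed_moment_EFin (sym_law_unit_ball nu01) nu_noatom theta0.
Let phi0E := signed_moment_EFin (sym_law_unit_ball phi001) phi0_noatom theta0.

(** The signed moments of independent factors convolve over the group of signs,
    and its two characters (sum and difference) turn convolution into
    multiplication. *)
Lemma signed_power_partial_product t s :
  (\int[P]_w (signed_power theta s (partial_product xi t w))%:E =
   (2^-1 * ((m0 false + m0 true) * (m false + m true) ^+ t +
      (-1) ^+ s * ((m0 false - m0 true) * (m false - m true) ^+ t)))%:E)%E.
Proof.
elim: t s => [|t IHt] s.
  rewrite (partial_product_initial xi0_law).
  - rewrite phi0E; congr EFin; rewrite -/m0 !expr0.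
    by case: s; rewrite ?expr1 ?expr0; field.
  - exact: measurable_signed_power.
  - exact: signed_power_ge0.
rewrite (partial_product_recursion nu01 phi001 xi0_law xi_law indep
  (op := addb) (F := signed_power theta)).
- under eq_bigr do rewrite IHt nuE -EFinM.
  rewrite sumEFin big_bool -/m !exprS; congr EFin.
  by case: s => /=; rewrite ?expr1 ?expr0; field.
- exact: measurable_signed_power.
- by move=> c x; exact: signed_power_ge0.
- by move=> b x y _ _; exact: signed_powerM.
Qed.

(** Both characters of the moments of nu have modulus at most 1, which gives
    the convergence of the geometric series and the invertibility of the
    denominators of the closed form. *)
Lemma alpha_moments :
  [/\ `|alpha * (m false + m true)| < 1, `|alpha * (m false - m true)| < 1,
      1 - alpha * (m false + m true) != 0 &
      1 - alpha * (m false - m true) != 0].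
Proof.
have /andP[a0 a1] := alpha01.
have m1 := signed_moment_sum_le1 (sym_law_unit_ball nu01) nu_noatom theta0.
have mf := signed_moment_ge0 (sym_law nu) theta false.
have mt := signed_moment_ge0 (sym_law nu) theta true.
have h (z : R) : `|z| <= 1 -> `|alpha * z| < 1.
  move=> z1; rewrite normrM gtr0_norm//; apply: le_lt_trans a1.
  by rewrite ler_piMr// ltW.
have h1 (z : R) : `|z| < 1 -> 1 - z != 0.
  by rewrite ltr_norml => /andP[_ z1]; rewrite subr_eq0 gt_eqF.
have A : `|alpha * (m false + m true)| < 1.
  by apply: h; rewrite ler_norml; apply/andP; rewrite /m; split; lra.
have B : `|alpha * (m false - m true)| < 1.
  by apply: h; rewrite ler_norml; apply/andP; rewrite /m; split; lra.
by split=> //; exact: h1.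
Qed.

Lemma signed_power_stopped_product s :
  (\int[P]_w (signed_power theta s (stopped_product xi T w))%:E =
   (2^-1 * (1 + alpha / (1 - alpha) * (1 - (m false + m true)))^-1 *
      (m0 false + m0 true) +
    (-1) ^+ s * (2^-1 * (1 - alpha) * (1 - alpha * (m false - m true))^-1 *
      (m0 false - m0 true)))%:E)%E.
Proof.
have [A B nA nB] := alpha_moments.
have na : 1 - alpha != 0 by rewrite subr_eq0 gt_eqF//; case/andP: alpha01.
rewrite (integral_stopped_product indep); last 2 first.
- exact: measurable_signed_power.
- exact: signed_power_ge0.
transitivity (\sum_(0 <= t <oo)
  (2^-1 * (1 - alpha) * (m0 false + m0 true) * (alpha * (m false + m true)) ^+ t +
   (-1) ^+ s * 2^-1 * (1 - alpha) * (m0 false - m0 true) *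
     (alpha * (m false - m true)) ^+ t)%:E)%E.
  apply: eq_eseriesr => t _.
  rewrite T_law signed_power_partial_product -EFinM !exprMn.
  by congr EFin; ring.
rewrite nneseries_geometric2//; congr EFin; field.
rewrite nB na /= (_ : _ + _ = 1 - alpha * (m false + m true))//; ring.
Qed.

Lemma expR_ln_stopped_product w : stopped_product xi T w != 0 ->
  expR (- theta * (- ln (\prod_(j < (T w).+1) `|xi j w|))) =
  `|stopped_product xi T w| `^ theta.
Proof.
by move=> M0; rewrite -normr_prod /powR normr_eq0 (negbTE M0) mulrNN.
Qed.

Lemma joint_transform (s : bool) :
  ('E_P[fun w =>
     (\1_[set w' | 0 < (-1) ^+ s * \prod_(k < (T w').+1) xi k w'] w *
      expR (- theta * (- ln (\prod_(j < (T w).+1) `|xi j w|))))%R])%E =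
   (2^-1 * (1 + alpha / (1 - alpha) *
        (\int[sym_law nu]_(x in `[-1, 1]) (1 - `|x| `^ theta)))^-1 *
      (\int[sym_law phi0]_(x in `[-1, 1]) (`|x| `^ theta)) +
    (-1) ^+ s * (2^-1 * (1 - alpha) *
      (1 - alpha *
         (- (\int[sym_law nu]_(x in `[-1, 0]) (`|x| `^ theta)) +
          (\int[sym_law nu]_(x in `]0, 1]) (`|x| `^ theta))))^-1 *
      (- (\int[sym_law phi0]_(x in `[-1, 0]) (`|x| `^ theta)) +
       (\int[sym_law phi0]_(x in `]0, 1]) (`|x| `^ theta)))))%:E.
Proof.
have nuB := sym_law_unit_ball nu01; have phiB := sym_law_unit_ball phi001.
rewrite Rintegral_abs_powR_complement// !Rintegral_abs_powR//.
rewrite !Rintegral_abs_powR_neg// !Rintegral_abs_powR_pos//.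
rewrite ![- signed_moment _ _ _ + _]addrC -signed_power_stopped_product.
rewrite unlock; apply: eq_integral => w _; congr EFin.
rewrite signed_powerE indicE; case: ifPn => [Ms|/negP Ms].
  (* a product of positive sign is nonzero, so the value of ln 0 does not enter *)
  rewrite mem_set// mul1r expR_ln_stopped_product//.
  by apply: contraTneq Ms => ->; rewrite mulr0 ltxx.
by rewrite memNset ?mul0r.
Qed.

Lemma marginal_transform :
  ('E_P[fun w =>
     (expR (- theta * (- ln (\prod_(j < (T w).+1) `|xi j w|))))%R])%E =
   ((1 + alpha / (1 - alpha) *
        (\int[sym_law nu]_(x in `[-1, 1]) (1 - `|x| `^ theta)))^-1 *
      (\int[sym_law phi0]_(x in `[-1, 1]) (`|x| `^ theta)))%:E.
Proof.
have nuB := sym_law_unit_ball nu01; have phiB := sym_law_unit_ball phi001.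
rewrite Rintegral_abs_powR_complement// !Rintegral_abs_powR//.
have mS s : measurable_fun setT
    (fun w => (signed_power theta s (stopped_product xi T w))%:E).
  apply/measurable_EFinP; apply: measurableT_comp; first exact: measurable_signed_power.
  exact: measurable_stopped_product.
have S0 s w : (0 <= (signed_power theta s (stopped_product xi T w))%:E)%E.
  by rewrite lee_fin signed_power_ge0.
transitivity (\int[P]_w ((signed_power theta false (stopped_product xi T w))%:E +
    (signed_power theta true (stopped_product xi T w))%:E))%E; last first.
  rewrite ge0_integralD// !signed_power_stopped_product -EFinD; congr EFin.
  rewrite -/m -/m0 expr0 expr1 mul1r mulN1r.
  rewrite addrACA subrr addr0 -!mulrA -mulrDl.
  by rewrite (_ : 2^-1 + 2^-1 = 1) ?mul1r//; field.
rewrite unlock; apply: ge0_ae_eq_integral => //.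
- apply/measurable_EFinP; apply: measurableT_comp => //.
  apply: measurable_funM => //; apply: measurableT_comp => //.
  apply: measurableT_comp => //.
  rewrite (_ : (fun w => _) = (fun w => `|stopped_product xi T w|)).
    exact: measurableT_comp (measurable_stopped_product _ _).
  by apply/funext => w; rewrite -normr_prod.
- exact: emeasurable_funD.
- by move=> w _; exact: adde_ge0.
apply: filterS stopped_product_neq0 => w Mw _.
rewrite expR_ln_stopped_product// -EFinD !signed_powerE expr0 expr1 mul1r mulN1r oppr_gt0.
by case: ltgtP Mw; rewrite ?addr0 ?add0r.
Qed.

End FixedExponent.

(** The flip carries [1/2, 1] onto [-1, 0], and 0 is not an atom. *)
Lemma signed_moment0_true (mu : probability R R) :
  on_unit_interval mu -> sym_law mu [set 0] = 0%E ->
  signed_moment (sym_law mu) 0 true = fine (mu `[2^-1, 1]%classic).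
Proof.
move=> mu01 mu_noatom.
rewrite -(Rintegral_abs_powR_neg (sym_law_unit_ball mu01) mu_noatom).
rewrite /Rintegral; under eq_integral do rewrite powRr0.
rewrite integral_cst// mul1e /sym_law /= /distribution /pushforward.
congr (fine (mu _)); apply/seteqP; split => p; rewrite /= !in_itv /affine_flip /=;
  by move=> /andP[? ?]; apply/andP; split; lra.
Qed.

Lemma signed_moment0_sum (mu : probability R R) :
  on_unit_interval mu -> sym_law mu [set 0] = 0%E ->
  signed_moment (sym_law mu) 0 false + signed_moment (sym_law mu) 0 true = 1.
Proof.
move=> mu01 mu_noatom.
rewrite -(Rintegral_abs_powR (sym_law_unit_ball mu01) mu_noatom (lexx 0)).
rewrite /Rintegral; under eq_integral do rewrite powRr0.
by rewrite integral_cst//= mul1e sym_law_unit_ball.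
Qed.

Lemma marginal_sign (s : bool) :
  P [set w | 0 < (-1) ^+ s * \prod_(k < (T w).+1) xi k w] =
  (2^-1 * (1 + (-1) ^+ s *
    ((1 + 2 * alpha / (1 - alpha) * fine (nu `[2^-1, 1]%classic))^-1 *
      (1 - 2 * fine (phi0 `[2^-1, 1]%classic)))))%:E.
Proof.
have [_ _ _ nB] := alpha_moments (lexx 0).
have na : 1 - alpha != 0 by rewrite subr_eq0 gt_eqF//; case/andP: alpha01.
(* at exponent 0 the signed power is the indicator of the sign, since 0 `^ 0 = 1 *)
transitivity (\int[P]_w (signed_power 0 s (stopped_product xi T w))%:E)%E.
  have mS : measurable [set w | 0 < (-1) ^+ s * stopped_product xi T w].
    rewrite -[X in measurable X]setTI.
    have mM : measurable_fun setT (fun w => (-1) ^+ s * stopped_product xi T w).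
      by apply: measurable_funM => //; exact: measurable_stopped_product.
    have := mM measurableT _ (measurable_itv `]0, +oo[); congr measurable.
    by apply/seteqP; split => w [_]; rewrite /= in_itv /= andbT; split.
  rewrite -[in LHS](setIT [set w | _]) -integral_indic//.
  by apply: eq_integral => w _; rewrite /signed_power powRr0 mulr1.
rewrite (signed_power_stopped_product (lexx 0)).
have sum1 := signed_moment0_sum nu01 nu_noatom.
have sum1' := signed_moment0_sum phi001 phi0_noatom.
rewrite -!signed_moment0_true//.
move: nB sum1 sum1'; set a := signed_moment _ 0 true; set b := signed_moment _ 0 false.
set a' := signed_moment _ 0 true; set b' := signed_moment _ 0 false.
move=> nB /(canRL (addrK _)) Eb /(canRL (addrK _)) Eb'.
rewrite Eb Eb' in nB *; congr EFin; field.
rewrite na /= (_ : _ + _ = 1 - alpha * (1 - a - a))//; ring.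
Qed.

End Transform.

(** * Bernoulli likelihoods and the law of the walk *)

Section BernoulliLikelihood.
Context {R : realType}.
Variable n : nat.
Implicit Types (b c : {ffun 'I_n -> bool}).

(** The indicator of the unit interval makes the likelihood nonnegative on the
    whole line; outside it [bernoulli_pmf] takes negative values. *)
Definition likelihood b (p : R) : R :=
  \1_(`[0, 1]%classic : set R) p * \prod_(i < n) bernoulli_pmf p (b i).

Definition signed_likelihood b (x : R) : R := likelihood b (2^-1 * (1 - x)).

Lemma likelihoodE b p : 0 <= p <= 1 ->
  likelihood b p = \prod_(i < n) bernoulli_pmf p (b i).
Proof. by move=> p01; rewrite /likelihood indicE mem_set ?mul1r//= in_itv. Qed.

Lemma likelihood_ge0 b p : 0 <= likelihood b p.
Proof.
rewrite /likelihood indicE; case: (boolP (p \in _)) => [|_]; last by rewrite mul0r.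
rewrite inE /= in_itv /= => p01; rewrite mul1r prodr_ge0// => i _.
by rewrite /bernoulli_pmf; case: ifP; case/andP: p01; rewrite ?subr_ge0.
Qed.

Lemma measurable_likelihood b : measurable_fun setT (likelihood b).
Proof.
apply: measurable_funM; first exact: measurable_indic.
by apply: measurable_prod => i _; exact: measurable_bernoulli_pmf.
Qed.

Lemma measurable_signed_likelihood b : measurable_fun setT (signed_likelihood b).
Proof.
apply: measurableT_comp; first exact: measurable_likelihood.
by apply: measurable_funM => //; exact: measurable_funB.
Qed.

Definition xor_ffun b c := [ffun i => b i (+) c i].

(** For one bit this is the identity
    (1 - xy)/2 = (1 - x)/2 * (1 + y)/2 + (1 + x)/2 * (1 - y)/2
    and its complement; for n bits, distribute the product of the n sums. *)
Lemma signed_likelihoodM b x y : -1 <= x <= 1 -> -1 <= y <= 1 ->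
  signed_likelihood b (x * y) =
  \sum_c signed_likelihood c x * signed_likelihood (xor_ffun b c) y.
Proof.
have half z : -1 <= z <= 1 -> 0 <= (2^-1 : R) * (1 - z) <= 1.
  by move=> /andP[? ?]; apply/andP; split; lra.
move=> x1 y1; have xy1 : -1 <= x * y <= 1.
  by move: x1 y1; rewrite -!ler_norml normrM => ? ?; exact: mulr_ile1.
rewrite /signed_likelihood likelihoodE ?half//.
under [RHS]eq_bigr do rewrite !likelihoodE ?half// -big_split.
transitivity (\sum_(c : {ffun 'I_n -> bool}) \prod_(i < n)
    (bernoulli_pmf (2^-1 * (1 - x)) (c i) *
     bernoulli_pmf (2^-1 * (1 - y)) (b i (+) c i))); last first.
  by apply: eq_bigr => c _; apply: eq_bigr => i _; rewrite ffunE.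
rewrite -(bigA_distr_bigA (fun (i : 'I_n) (a : bool) =>
  bernoulli_pmf (2^-1 * (1 - x)) a * bernoulli_pmf (2^-1 * (1 - y)) (b i (+) a))).
apply: eq_bigr => i _; rewrite big_bool /bernoulli_pmf.
by case: (b i) => /=; field.
Qed.

Lemma integral_likelihood (Q : probability R R) b :
  (\int[Q]_(p in `[0%R, 1%R]) (\prod_(i < n) bernoulli_pmf p (b i))%:E =
   \int[Q]_p (likelihood b p)%:E)%E.
Proof.
rewrite integral_mkcond; apply: eq_integral => p _.
rewrite patchE /likelihood indicE; case: ifP => _; first by rewrite mul1r.
by rewrite mul0r.
Qed.

End BernoulliLikelihood.

Section DeFinetti.
Context {R : realType} {d : measure_display} {Omega : measurableType d}.
Variable P : probability Omega R.

(** A mixture of product laws is symmetric in the coordinates. *)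
Lemma exchangeable_of_mixture (Q : probability R R) (X : nat -> {mfun Omega >-> bool}) :
  (forall (n : nat) (b : 'I_n -> bool),
      P [set w | forall i : 'I_n, X i w = b i] =
      (\int[Q]_(p in `[0%R, 1%R])
         (\prod_(i < n) bernoulli_pmf (p : R) (b i))%:E)%E) ->
  exchangeable P X.
Proof.
move=> fdd n s b.
have -> : [set w | forall i : 'I_n, X (s i) w = b i] =
    [set w | forall i : 'I_n, X i w = b ((s^-1)%g i)].
  apply/seteqP; split => w /= h i; first by rewrite -h permKV.
  by rewrite h permK.
rewrite !fdd; apply: eq_integral => p _; congr EFin.
by rewrite (reindex_inj (@perm_inj _ s))/=; apply: eq_bigr => i _; rewrite permK.
Qed.

Lemma sigma_of_sequence_sigma_algebra (X : nat -> {mfun Omega >-> bool}) :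
  sigma_algebra setT (sigma_of_sequence X).
Proof. exact: smallest_sigma_algebra. Qed.

Lemma sigma_of_sequence_measurable (X : nat -> {mfun Omega >-> bool}) :
  sigma_of_sequence X `<=` measurable.
Proof.
apply: smallest_sub; first exact: sigma_algebra_measurable.
by move=> A [i _]; exact: g_preimage_measurable.
Qed.

Lemma cylinder_sigma_of_sequence (X : nat -> {mfun Omega >-> bool}) n (b : 'I_n -> bool) :
  sigma_of_sequence X [set w | forall i : 'I_n, X i w = b i].
Proof.
rewrite (_ : [set w | _] = \bigcap_(i in [set: 'I_n]) (X i @^-1` [set b i])).
  pose G := \bigcup_i g_sigma_algebra_preimage (X i).
  apply: (@fin_bigcap_measurable _ (g_sigma_algebraType G)) => // i _.
  apply: sub_sigma_algebra; exists (i : nat) => //.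
  by exists [set b i] => //; rewrite setTI.
by apply/seteqP; split => w /= h i => [_|]; exact: h.
Qed.

(** The walk at time t is a function of its start and of the first t
    increments. *)
Lemma sigma_of_walk (X Z : nat -> nat -> {mfun Omega >-> bool}) (F : set (set Omega)) t :
  sigma_algebra setT F ->
  (forall t i w, X t.+1 i w = X t i w (+) Z t i w) ->
  sigma_of_sequence (X 0%N) `<=` F ->
  (forall s, (s < t)%N -> sigma_of_sequence (Z s) `<=` F) ->
  sigma_of_sequence (X t) `<=` F.
Proof.
move=> sF walk X0; elim: t => [//|t IHt] ZF.
have {IHt} XF : sigma_of_sequence (X t) `<=` F.
  by apply: IHt => s st; apply: ZF; exact: ltnW.
apply: smallest_sub => // _ [i _ [B _ <-]].
have gen (Y : nat -> {mfun Omega >-> bool}) C :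
    sigma_of_sequence Y `<=` F -> F (Y i @^-1` C).
  move=> YF; apply: YF; apply: sub_sigma_algebra.
  by exists i => //; exists C => //; rewrite setTI.
have ZtF := ZF _ (ltnSn t).
have -> : setT `&` X t.+1 i @^-1` B =
    (X t i @^-1` [set false] `&` Z t i @^-1` B) `|`
    (X t i @^-1` [set true] `&` Z t i @^-1` (negb @^-1` B)).
  rewrite setTI; apply/seteqP; split => w /=; rewrite walk.
    by case: (X t i w) => /=; [right|left].
  by case=> -[->].
rewrite -bigcup2E; have [F0 _ FU] := sF; apply: FU => -[|[|k]] //=.
  by apply: (sigma_algebraI sF); exact: gen.
by apply: (sigma_algebraI sF); exact: gen.
Qed.

(** The total probability formula over the words c spelled by the first
    summand: then the second one has to spell the bitwise difference of b and
    c, which is also their bitwise sum. *)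
Lemma cylinder_split (X Z Y : nat -> {mfun Omega >-> bool}) n (b : {ffun 'I_n -> bool}) :
  independent_classes P (sigma_of_sequence X) (sigma_of_sequence Z) ->
  (forall i w, Y i w = X i w (+) Z i w) ->
  P [set w | forall i : 'I_n, Y i w = b i] =
  (\sum_(c : {ffun 'I_n -> bool}) (P [set w | forall i : 'I_n, X i w = c i] *
     P [set w | forall i : 'I_n, Z i w = xor_ffun b c i]))%E.
Proof.
move=> XZ YE.
pose E (c : {ffun 'I_n -> bool}) := [set w | forall i : 'I_n, X i w = c i] `&`
  [set w | forall i : 'I_n, Z i w = xor_ffun b c i].
have mE c : measurable (E c).
  apply: measurableI; apply: sigma_of_sequence_measurable;
    exact: cylinder_sigma_of_sequence.
have -> : [set w | forall i : 'I_n, Y i w = b i] = \bigcup_(c in setT) E c.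
  apply/seteqP; split => w /=.
    move=> h; exists [ffun i : 'I_n => X i w] => //.
    by split=> i; rewrite !ffunE// -h YE addbAC addbb.
  by move=> [c _ [/= Xc Zc]] i; rewrite YE Xc Zc ffunE addbC addbK.
have -> : [set: {ffun 'I_n -> bool}] = [set` index_enum {ffun 'I_n -> bool}].
  by apply/seteqP; split => // c _ /=; rewrite mem_index_enum.
rewrite measure_fin_bigcup//; last first.
  by move=> c c' _ _ [w [[/= Xc _] [/= Xc' _]]]; apply/ffunP => i; rewrite -Xc -Xc'.
rewrite -fsbig_seq ?index_enum_uniq//.
apply: eq_bigr => c _.
by apply: XZ; exact: cylinder_sigma_of_sequence.
Qed.

End DeFinetti.

Section Walk.
Context {R : realType} {d : measure_display} {Omega : measurableType d}.
Variables (P : probability Omega R) (nu phi0 : probability R R).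
Variables X Z : nat -> nat -> {mfun Omega >-> bool}.
Hypothesis XZ : de_finetti_walk P nu phi0 X Z.

Lemma walk_increment_independent t :
  independent_classes P (sigma_of_sequence (X t)) (sigma_of_sequence (Z t)).
Proof.
case: XZ => _ _ ind walk A B XA ZB.
pose G := adjoin (sigma_of_sequence (X 0%N)) (fun t => sigma_of_sequence (Z t)).
pose S := [set i : option nat | if i is Some s then (s < t)%N else true].
have GS s : S s -> G s `<=` <<s \bigcup_(i in S) G i>>.
  by move=> Ss C GC; apply: sub_sigma_algebra; exists s.
apply: (independent_grouping (G := G) (S := S) (k := Some t) ind) ZB.
- by case=> [s|]; exact: sigma_of_sequence_sigma_algebra.
- by case=> [s|]; exact: sigma_of_sequence_measurable.
- by rewrite /S /= ltnn.
apply: (sigma_of_walk _ walk) XA; first exact: smallest_sigma_algebra.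
- exact: (GS None).
- by move=> s st; exact: (GS (Some s)).
Qed.

(** The filtration is enlarged by T from the start: T is then known at time 0,
    and the increments remain independent of the past. *)
Lemma stopping_time_of_independent (T : {RV P >-> nat}) :
  mutually_independent P
    (adjoin (g_sigma_algebra_preimage T)
      (adjoin (sigma_of_sequence (X 0%N))
              (fun t : nat => sigma_of_sequence (Z t)))) ->
  stopping_time_of_walk P X Z T.
Proof.
case: XZ => _ _ _ walk ind.
pose G := adjoin (g_sigma_algebra_preimage T) (adjoin (sigma_of_sequence (X 0%N))
              (fun t : nat => sigma_of_sequence (Z t))).
pose S t := [set i : option (option nat) |
  if i is Some (Some s) then (s < t)%N else true].
have GS t i : S t i -> G i `<=` <<s \bigcup_(i in S t) G i>>.
  by move=> Si C GC; apply: sub_sigma_algebra; exists i.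
have sG i : sigma_algebra setT (G i).
  by case: i => [[s|]|]; [exact: sigma_of_sequence_sigma_algebra..|
    exact: sigma_algebra_g_preimage].
have mG i : G i `<=` measurable.
  by case: i => [[s|]|]; [exact: sigma_of_sequence_measurable..|
    exact: g_preimage_measurable].
exists (fun t => <<s \bigcup_(i in S t) G i>>); split.
- move=> t; split; first exact: smallest_sigma_algebra.
  apply: smallest_sub; first exact: sigma_algebra_measurable.
  by move=> C [i _ /mG].
- move=> s t st; apply: smallest_sub; first exact: smallest_sigma_algebra.
  move=> C [i Si GC]; apply: (GS t i) => //.
  by case: i Si {GC} => [[r|]|] //= rs; exact: leq_trans rs st.
- move=> t; apply: (sigma_of_walk _ walk); first exact: smallest_sigma_algebra.
  + exact: (GS t (Some None)).
  + by move=> s st; exact: (GS t (Some (Some s))).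
- move=> t; apply: mutually_independent2.
  + exact: smallest_sigma_algebra.
  + exact: sigma_of_sequence_sigma_algebra.
  + apply: (independent_grouping (k := Some (Some t)) ind) => //.
    by rewrite /S /= ltnn.
- move=> t; apply: (GS t None) => //.
  by exists [set n | (n <= t)%N] => //; rewrite setTI.
Qed.

Context {d' : measure_display} {Omega' : measurableType d'}.
Variables (P' : probability Omega' R) (xi : nat -> {RV P' >-> R}) (T : {RV P' >-> nat}).
Hypothesis xi0_law : has_law P' (xi 0%N) (sym_law phi0).
Hypothesis xi_law : forall j : nat, has_law P' (xi j.+1) (sym_law nu).
Hypothesis indep : mutually_independent P'
     (adjoin (g_sigma_algebra_preimage T)
             (fun j : nat => g_sigma_algebra_preimage (xi j))).

Lemma mixture_signed_likelihood (mu : probability R R) (Y : nat -> {mfun Omega >-> bool})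
    n (b : {ffun 'I_n -> bool}) :
  de_finetti_sequence P mu Y ->
  P [set w | forall i : 'I_n, Y i w = b i] =
  (\int[sym_law mu]_x (signed_likelihood b x)%:E)%E.
Proof.
case=> _ _ ->; rewrite integral_likelihood integral_sym_law; last 2 first.
- by apply/measurable_EFinP; exact: measurable_signed_likelihood.
- by move=> x; rewrite lee_fin likelihood_ge0.
apply: eq_integral => p _; congr (likelihood b _)%:E.
by rewrite /affine_flip; field.
Qed.

(** Both sides satisfy the recursion over words with the same initial values:
    the left one by [cylinder_split], the right one by
    [partial_product_recursion]. *)
Lemma walk_cylinder t n (b : {ffun 'I_n -> bool}) :
  P [set w | forall i : 'I_n, X t i w = b i] =
  (\int[P']_w (signed_likelihood b (partial_product xi t w))%:E)%E.
Proof.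
have [X0 Zt _ walk] := XZ.
have [phi001 _ _] := X0; have [nu01 _ _] := Zt 0%N.
elim: t b => [|t IHt] b.
  rewrite (mixture_signed_likelihood _ X0) (partial_product_initial xi0_law)//.
  - exact: measurable_signed_likelihood.
  - by move=> x; exact: likelihood_ge0.
rewrite (cylinder_split b (@walk_increment_independent t) (walk t)).
rewrite (partial_product_recursion nu01 phi001 xi0_law xi_law indep
  (op := @xor_ffun n) (F := @signed_likelihood R n)).
- by apply: eq_bigr => c _; rewrite IHt (mixture_signed_likelihood _ (Zt t)).
- exact: measurable_signed_likelihood.
- by move=> c x; exact: likelihood_ge0.
- exact: signed_likelihoodM.
Qed.

Lemma walk_de_finetti t :
  de_finetti_sequence P (distribution P' (product_parameter xi t)) (X t).
Proof.
have [[phi001 _ _] Zt _ _] := XZ; have [nu01 _ _] := Zt 0%N.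
have fdd n (b : 'I_n -> bool) : P [set w | forall i : 'I_n, X t i w = b i] =
    (\int[distribution P' (product_parameter xi t)]_(p in `[0%R, 1%R])
         (\prod_(i < n) bernoulli_pmf (p : R) (b i))%:E)%E.
  transitivity (P [set w | forall i : 'I_n, X t i w = [ffun i => b i] i]).
    by congr (P _); apply/seteqP; split => w /= h i; have := h i; rewrite ffunE.
  rewrite walk_cylinder.
  under [RHS]eq_integral do under eq_bigr do rewrite -[b _](ffunE b).
  rewrite integral_likelihood ge0_integral_distribution//.
  - by apply/measurable_EFinP; exact: measurable_likelihood.
  - by move=> p; rewrite lee_fin likelihood_ge0.
split => //; last exact: (exchangeable_of_mixture fdd).
rewrite /on_unit_interval /= /distribution /pushforward.
set A := (X in P' X = _).
have mA : measurable A by apply: (measurable_funPTI (product_parameter xi t)).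
have : P' (~` A) = 0%E.
  apply: measure_negligible; first exact: measurableC.
  have := partial_product_unit_ball nu01 phi001 xi0_law xi_law t.
  apply: filterS => w h; rewrite /A /= in_itv /product_parameter /=.
  by case/andP: h; rewrite /partial_product => ? ?; apply/andP; split; lra.
rewrite probability_setC// => /eqP; rewrite sube_eq ?fin_num_measure// add0e.
by move/eqP.
Qed.

End Walk.

Theorem proposition8 (R : realType)
  (nu phi0 : probability R R)
  (nu01 : on_unit_interval nu) (phi001 : on_unit_interval phi0)
  (nu_noatom : sym_law nu [set 0] = 0%E)
  (phi0_noatom : sym_law phi0 [set 0] = 0%E)
  (alpha : R) (alpha01 : 0 < alpha < 1)
  (d : measure_display) (Omega : measurableType d) (P : probability Omega R)
  (xi : nat -> {RV P >-> R}) (T : {RV P >-> nat})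
  (xi0_law : has_law P (xi 0%N) (sym_law phi0))
  (xi_law : forall j : nat, has_law P (xi j.+1) (sym_law nu))
  (T_law : geometric_time P alpha T)
  (indep : mutually_independent P
     (adjoin (g_sigma_algebra_preimage T)
             (fun j : nat => g_sigma_algebra_preimage (xi j)))) :
  [/\ (* the walk behind the variables xi and T *)
      (forall (d' : measure_display) (Omega' : measurableType d')
         (P' : probability Omega' R)
         (X Z : nat -> nat -> {mfun Omega' >-> bool}),
         de_finetti_walk P' nu phi0 X Z ->
         (forall t : nat,
            de_finetti_sequence P' (distribution P (product_parameter xi t))
              (X t)) /\
         (forall T' : {RV P' >-> nat}, geometric_time P' alpha T' ->
            mutually_independent P'
              (adjoin (g_sigma_algebra_preimage T')
                (adjoin (sigma_of_sequence (X 0%N))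
                        (fun t : nat => sigma_of_sequence (Z t)))) ->
            stopping_time_of_walk P' X Z T')),
      (* joint transform; [s = false] is the sign +, [s = true] the sign -;
         the product almost surely does not vanish, so the value of [ln 0] is
         irrelevant *)
      (forall (theta : R) (s : bool), 0 <= theta ->
         ('E_P[fun w =>
           (\1_[set w' | 0 < (-1) ^+ s * \prod_(k < (T w').+1) xi k w'] w *
            expR (- theta * (- ln (\prod_(j < (T w).+1) `|xi j w|))))%R])%E =
         (2^-1 * (1 + alpha / (1 - alpha) *
              (\int[sym_law nu]_(x in `[-1, 1]) (1 - `|x| `^ theta)))^-1 *
            (\int[sym_law phi0]_(x in `[-1, 1]) (`|x| `^ theta)) +
          (-1) ^+ s * (2^-1 * (1 - alpha) *
            (1 - alpha *
               (- (\int[sym_law nu]_(x in `[-1, 0]) (`|x| `^ theta)) +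
                (\int[sym_law nu]_(x in `]0, 1]) (`|x| `^ theta))))^-1 *
            (- (\int[sym_law phi0]_(x in `[-1, 0]) (`|x| `^ theta)) +
             (\int[sym_law phi0]_(x in `]0, 1]) (`|x| `^ theta)))))%:E),
      (* marginal transform *)
      (forall theta : R, 0 <= theta ->
         ('E_P[fun w =>
           (expR (- theta * (- ln (\prod_(j < (T w).+1) `|xi j w|))))%R])%E =
         ((1 + alpha / (1 - alpha) *
              (\int[sym_law nu]_(x in `[-1, 1]) (1 - `|x| `^ theta)))^-1 *
            (\int[sym_law phi0]_(x in `[-1, 1]) (`|x| `^ theta)))%:E) &
      (* marginal sign *)
      (forall s : bool,
         P [set w | 0 < (-1) ^+ s * \prod_(k < (T w).+1) xi k w] =
         (2^-1 * (1 + (-1) ^+ s *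
            ((1 + 2 * alpha / (1 - alpha) * fine (nu `[2^-1, 1]%classic))^-1 *
             (1 - 2 * fine (phi0 `[2^-1, 1]%classic)))))%:E)].
Proof.
split.
- move=> d' Omega' P' X Z XZ; split; last first.
    by move=> T' _; exact: (stopping_time_of_independent XZ).
  by move=> t; exact: (walk_de_finetti XZ xi0_law xi_law indep).
- by move=> theta s theta0; exact: (joint_transform nu01 phi001 nu_noatom
    phi0_noatom alpha01 xi0_law xi_law T_law indep).
- by move=> theta theta0; exact: (marginal_transform nu01 phi001 nu_noatom
    phi0_noatom alpha01 xi0_law xi_law T_law indep).
- by move=> s; exact: (marginal_sign nu01 phi001 nu_noatom
    phi0_noatom alpha01 xi0_law xi_law T_law indep).
Qed.
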